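(* Let $N,M\ge 1$ be integers and let $(\mathcal{F}_{i, j} : 1 \leq i \leq N, 1 \leq j \leq M)$ be a biparameter filtration satisfying the $(F_4)$ condition in a discrete probability space $(\Omega, \mathcal{F}, \mathbb{P})$. Then there is a double-indexed sequence of probability spaces $\big((S_{i,j}, \mathcal{S}_{i,j}, \mu_{i,j}) : 1\le i\le N, 1\le j\le M\big)$ such that for any double-indexed martingale $(f_{i, j} : 1 \leq i \leq N, 1 \leq j \leq M)$ on $(\Omega, \mathcal{F}, \mathbb{P})$ with respect to $(\mathcal{F}_{i, j} : 1 \leq i \leq N, 1 \leq j \leq M)$ there is a double-indexed sequence $(\tilde{f}_{i, j} : 1 \leq i \leq N, 1 \leq j \leq M)$ of random variables on $$(S, \mathcal{S}, \mu) = \bigotimes_{i = 1}^N \bigotimes_{j=1}^M \big(S_{i,j},\mathcal{S}_{i,j},\mu_{i,j}\big)$$ which is a martingale with respect to the canonical biparameter filtration of $(S,\mathcal{S},\mu)$ and has the same joint distribution as $(f_{i, j} : 1 \leq i \leq N, 1 \leq j \leq M)$.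
   Context: A probability space $(\Omega,\mathcal{F},\mathbb{P})$ is discrete if $\Omega$ is at most countable. A double-indexed family of sub-$\sigma$-fields $(\mathcal{F}_{i,j})$ of $\mathcal{F}$ is a biparameter filtration if $\mathcal{F}_{i,j}\subset \mathcal{F}_{i,j+1}$ and $\mathcal{F}_{i,j}\subset\mathcal{F}_{i+1,j}$ for all indices. It satisfies the $(F_4)$ condition if for all indices $i,j,i',j'$ and all integrable $f$, $$\mathbb{E}\big(\mathbb{E}(f \mid \mathcal{F}_{i, j}) \mid \mathcal{F}_{i', j'}\big) = \mathbb{E}\big(f \mid \mathcal{F}_{\min\{i,i'\}, \min\{j,j'\}}\big).$$ A family of (real-valued) integrable random variables $(f_{i,j})$ is a martingale with respect to $(\mathcal{F}_{i,j})$ if $\mathbb{E}(f_{i',j'}\mid\mathcal{F}_{i,j})=f_{i,j}$ whenever $i'\ge i$ and $j'\ge j$. On the product space $\bigotimes_{i=1}^N\bigotimes_{j=1}^M (S_{i,j},\mathcal{S}_{i,j},\mu_{i,j})$ the canonical biparameter filtration is the family whose $(i,j)$-th $\sigma$-field is generated by the projection $s\mapsto (s_{i',j'} : 1\le i'\le i,\ 1\le j'\le j)$. Note that the spaces $(S_{i,j},\mathcal{S}_{i,j},\mu_{i,j})$ depend only on the filtration and not on the martingale. *)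

(* Defs.v *)
From HB Require Import structures.
From mathcomp Require Import all_boot all_order all_algebra.
From mathcomp Require Import all_classical all_reals all_analysis.

Set Implicit Arguments.
Unset Strict Implicit.
Unset Printing Implicit Defensive.

Import Order.TTheory GRing.Theory Num.Theory.
Import numFieldNormedType.Exports.

Local Open Scope classical_set_scope.
Local Open Scope ring_scope.
Local Open Scope ereal_scope.

Section prod_space.
Context {I : Type} {d : I -> measure_display}.

Definition prod_space (S : forall k, measurableType (d k)) : Type :=
  forall k, S k.

Variable S : forall k, measurableType (d k).

HB.instance Definition _ := Pointed.copy (prod_space S) (forall k, S k).

Definition prod_space_coord (k : I) (s : prod_space S) : S k := s k.

Definition prod_space_cylinders : set (set (prod_space S)) :=
  \bigcup_k preimage_set_system setT (@prod_space_coord k) measurable.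

Definition prod_space_display : (I -> measure_display) -> measure_display.
Proof. by move=> _; exact: default_measure_display. Qed.

HB.instance Definition _ :=
  @isMeasurable.Build (prod_space_display d) (prod_space S)
    <<s prod_space_cylinders >>
    (@sigma_algebra0 _ setT prod_space_cylinders)
    (@sigma_algebraC _ prod_space_cylinders)
    (@sigma_algebra_bigcup _ setT prod_space_cylinders).

End prod_space.

Definition prod_space_proj (I : Type) (d : I -> measure_display)
    (S : forall k, measurableType (d k)) (D : pred I) (s : prod_space S) :
    prod_space (fun k : {k | D k} => S (sval k)) :=
  fun k => s (sval k).

Arguments prod_space_coord {I d} S k s.
Arguments prod_space_cylinders {I d} S.
Arguments prod_space_proj {I d} S D s.

(* By Dynkin's pi-lambda theorem, the values on boxes determine nu uniquely. *)
Definition is_product_probability (R : realType) (I : finType)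
    (d : I -> measure_display) (S : forall k, measurableType (d k))
    (mu : forall k, probability (S k) R) (nu : probability (prod_space S) R) :=
  forall A : forall k, set (S k), (forall k, measurable (A k)) ->
    nu [set s : prod_space S | forall k, A k (s k)] = \prod_(k : I) mu k (A k).

Section conditional_expectation.
Context {R : realType} {d : measure_display} {T : measurableType d}.
Variable P : probability T R.

(* g is a version of E(f | G), for f integrable. *)
Definition is_cond_expectation (G : set (set T)) (f g : T -> R) :=
  [/\ P.-integrable setT (EFin \o f),
      P.-integrable setT (EFin \o g),
      preimage_set_system setT g measurable `<=` G &
      forall A, G A -> \int[P]_(w in A) (g w)%:E = \int[P]_(w in A) (f w)%:E].

End conditional_expectation.

Section biparameter.
Context {R : realType} {d : measure_display} {T : measurableType d}.
Context {N M : nat}.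
Implicit Type F : 'I_N -> 'I_M -> set (set T).

Definition biparameter_filtration F :=
  [/\ forall i j, sigma_algebra setT (F i j),
      forall i j, F i j `<=` measurable,
      forall i (j j' : 'I_M), j' = j.+1 :> nat -> F i j `<=` F i j' &
      forall (i i' : 'I_N) j, i' = i.+1 :> nat -> F i j `<=` F i' j].

(* Conditional expectations are only defined up to null sets: g, h and k range
   over all versions of the three of them, compared almost surely. *)
Definition F4_condition (P : probability T R) F :=
  forall (i i' : 'I_N) (j j' : 'I_M) (f g h k : T -> R),
    is_cond_expectation P (F i j) f g ->
    is_cond_expectation P (F i' j') g h ->
    is_cond_expectation P (F (Order.min i i') (Order.min j j')) f k ->
    {ae P, forall w, h w = k w}.

(* The cases (i', j') = (i, j) contain integrability and adaptedness. *)
Definition biparameter_martingale (P : probability T R) F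
    (f : 'I_N -> 'I_M -> T -> R) :=
  forall (i i' : 'I_N) (j j' : 'I_M), (i <= i')%N -> (j <= j')%N ->
    is_cond_expectation P (F i j) (f i' j') (f i j).

Definition random_vector (f : 'I_N -> 'I_M -> T -> R) (w : T) :
    prod_space (fun _ : 'I_N * 'I_M => measurableTypeR R) :=
  fun p => f p.1 p.2 w.

End biparameter.

Definition same_joint_distribution (R : realType) (N M : nat)
    (d d' : measure_display) (T : measurableType d) (T' : measurableType d')
    (P : probability T R) (P' : probability T' R)
    (f : 'I_N -> 'I_M -> T -> R) (f' : 'I_N -> 'I_M -> T' -> R) :=
  forall B : set (prod_space (fun _ : 'I_N * 'I_M => measurableTypeR R)),
    measurable B ->
    pushforward P (random_vector f) B = pushforward P' (random_vector f') B.

Definition canonical_filtration (N M : nat) (d : 'I_N * 'I_M -> measure_display)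
    (S : forall p, measurableType (d p)) (i : 'I_N) (j : 'I_M) :
    set (set (prod_space S)) :=
  g_sigma_algebra_preimage
    (prod_space_proj S (fun p => (p.1 <= i)%N && (p.2 <= j)%N)).
Arguments canonical_filtration {N M d} S i j.

(* Main.v *)
Require Import Defs.
From HB Require Import structures.
From mathcomp Require Import all_boot all_order all_algebra.
From mathcomp Require Import all_classical all_reals all_analysis.
From mathcomp Require Import zify.

Set Implicit Arguments.
Unset Strict Implicit.
Unset Printing Implicit Defensive.

Import Order.TTheory GRing.Theory Num.Theory.
Import numFieldNormedType.Exports.

Local Open Scope classical_set_scope.
Local Open Scope ring_scope.

(** Since Omega is countable, every F_{i,j} is generated by a nat-valued random
    variable Y_{i,j} labelling its atoms, and f_{i,j} is a function of Y_{i,j}.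
    By (F_4), the law of Y_p given all the lexicographically earlier Y_q depends
    only on the Y_q with q < p in the product order. Hence the family (Y_p) can
    be simulated from independent uniform variables s_p: define X_p from s_p and
    (X_q)_{q < p} by the quantile function of this conditional law. Then
    {X = x} is a box, and (X_p) has the law of (Y_p) by the chain rule.

    Put f'_p = f_p(X_p). On an event E = {X_q = x_q for q <= p}, the whole of X
    is a function of coordinates outside the rectangle {q <= p}, hence is
    independent of the canonical sigma-field C_p. So for A in C_p the law of X
    on A /\ E is a multiple of its law on E, which is the law of Y on an event
    of F_p; there the martingale property of f applies, and it remains to sum
    over the countably many E. *)

(** * Atoms of a sigma-field on a countable space *)

(** Two points are equivalent when no set of [G] separates them. By countability each class is a
    countable intersection of sets of [G], and every set of [G] is a union of classes; [Y] numbers a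
    class by the label of a chosen representative. *)
Lemma sigma_algebra_countable_rv (T : pointedType) (G : set (set T)) :
  countable [set: T] -> sigma_algebra setT G ->
  exists Y : T -> nat, forall A, G A <-> exists B, A = Y @^-1` B.
Proof.
move=> /countable_injP[f finj] [G0 GC GU].
have GC' A : G A -> G (~` A) by move=> /GC; rewrite setTD.
have GT : G setT by rewrite -setC0; exact: GC'.
pose eqG w w' := forall A, G A -> A w = A w'.
pose rep w := get [set w' | eqG w w'].
have repP w : eqG w (rep w).
  by apply: (@getPex _ [set w' | eqG w w']); exists w.
have repE w w' : eqG w w' -> rep w = rep w'.
  move=> ww'; congr get; apply/seteqP; split => v /= + A GA => /(_ A GA) <-.
    exact/esym/ww'.
  exact: ww'.
pose Y w := f (rep w).
have YE w w' : Y w = Y w' -> eqG w w'.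
  move=> /finj; rewrite !inE => /(_ Logic.I Logic.I) ww' A GA.
  by rewrite (repP w A GA) ww' -(repP w').
exists Y => A; split=> [GA|[B ->]].
  exists (Y @` A); apply/seteqP; split=> [w Aw|w [v Av /YE vw]]; first by exists w.
  by rewrite -(vw A GA).
have Gfib n : G (Y @^-1` [set n]).
  have [[w wn]|nw] := pselect (exists w, Y w = n); last first.
    rewrite (_ : _ @^-1` _ = set0)//.
    by apply/seteqP; split => // v /= vn; apply: nw; exists v.
  (* The atom of [w] is cut out by one separating set per point outside it. *)
  have sep m : exists A, G A /\ A w /\
      forall v, f v = m -> A v -> eqG w v.
    have [[v [vm nwv]]|nv] := pselect (exists v, f v = m /\ ~ eqG w v); last first.
      exists setT; do 2 split => //; move=> v vm _; apply: contrapT => wv.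
      by apply: nv; exists v.
    move/existsNP : nwv => [C] /not_implyP[GC1 Cwv].
    have vE u : f u = m -> u = v by rewrite -vm => /finj; apply; rewrite inE.
    have [Cw|Cw] := pselect (C w).
      exists C; do 2 split=> //; move=> u /vE -> Cv.
      by exfalso; apply: Cwv; apply/propext.
    exists (~` C); split; [exact: GC'|split=> //].
    move=> u /vE -> Cv.
    by exfalso; apply: Cwv; apply/propext.
  have [C CP] := choice sep.
  rewrite (_ : _ @^-1` _ = ~` \bigcup_m ~` (C m)).
    by apply/GC'/GU => m; apply: GC'; case: (CP m).
  apply/seteqP; split=> [v vn [m _]|v vC] /=.
    have [GCm [Cmw _]] := CP m; apply.
    by move: vn; rewrite -wn => /YE ->.
  rewrite -wn /Y (@repE v w)// => C0 GC0.
  have Cv : C (f v) v by apply: contrapT => Cv; apply: vC; exists (f v).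
  by have [_ [_ /(_ v erefl Cv)/(_ C0 GC0)->]] := CP (f v).
rewrite (_ : _ @^-1` B = \bigcup_n (if n \in B then Y @^-1` [set n] else set0)).
  by apply: GU => n; case: ifP.
apply/seteqP; split=> [w Bw|w [n _]].
  by exists (Y w) => //; rewrite mem_set.
by case: ifPn => // /set_mem Bn /= ->.
Qed.
(** * Random variables with values in nat *)

Section nat_valued.
Context {R : realType}.

Lemma measurable_nat_valued d (T : measurableType d) (X : T -> nat) :
  (forall n, measurable (X @^-1` [set n])) -> measurable_fun setT X.
Proof.
move=> mX _ B _; rewrite setTI (_ : _ @^-1` _ = \bigcup_(n in B) X @^-1` [set n]).
  by apply: bigcup_measurable => n _; exact: mX.
by apply/seteqP; split=> [w Bw|w [n Bn /= ->]//]; exists (X w).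
Qed.

Lemma measurable_nat_preimage d (T : measurableType d) (X : T -> nat)
    (B : set nat) :
  measurable_fun setT X -> measurable (X @^-1` B).
Proof. by move=> mX; rewrite -[_ @^-1` _]setTI; exact: mX. Qed.

Lemma measurable_nat_comp d d' (T : measurableType d) (U : sigmaRingType d')
    (X : T -> nat) (g : nat -> U) (D : set T) :
  measurable_fun setT X -> measurable_fun D (g \o X).
Proof.
move=> mX mD B mB; apply: measurableI => //; rewrite comp_preimage.
exact: measurable_nat_preimage.
Qed.

Lemma nat_trivIset (T : Type) (X : T -> nat) (D : set T) :
  trivIset setT (fun n => D `&` X @^-1` [set n]).
Proof. by move=> i j _ _ [w [[_ /= <-] [_ /= <-]]]. Qed.

Lemma nat_bigcup (T : Type) (X : T -> nat) (D : set T) :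
  D = \bigcup_n (D `&` X @^-1` [set n]).
Proof. by apply/seteqP; split=> [w Dw|w [n _ []]//]; exists (X w). Qed.

Lemma measure_nat_valued d (T : measurableType d) (P : {measure set T -> \bar R})
    (X : T -> nat) (D : set T) : measurable D -> measurable_fun setT X ->
  (P D = \sum_(0 <= n <oo) P (D `&` X @^-1` [set n]))%E.
Proof.
move=> mD mX; rewrite {1}(nat_bigcup X D) measure_semi_bigcup//.
- by move=> n; apply: measurableI => //; exact: measurable_nat_preimage.
- exact: nat_trivIset.
- by rewrite -nat_bigcup.
Qed.

Lemma ge0_integral_nat_valued d (T : measurableType d)
    (P : {measure set T -> \bar R}) (X : T -> nat) (D : set T) (g : nat -> \bar R) :
  measurable D -> measurable_fun setT X -> (forall n, 0 <= g n)%E ->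
  (\int[P]_(w in D) g (X w) =
   \sum_(0 <= n <oo) g n * P (D `&` X @^-1` [set n]))%E.
Proof.
move=> mD mX g0.
have mDX n : measurable (D `&` X @^-1` [set n]).
  by apply: measurableI => //; exact: measurable_nat_preimage.
rewrite [in LHS](nat_bigcup X D) ge0_integral_bigcup//.
- apply: eq_eseriesr => n _; rewrite -integral_cst//; apply: eq_integral => w.
  by rewrite inE => -[_ /= ->].
- rewrite -nat_bigcup -[X in measurable_fun _ X]/(g \o X).
  exact: measurable_nat_comp mX.
- exact: nat_trivIset.
Qed.

Section scale.
Context d d' (T : measurableType d) (T' : measurableType d').
Variables (P : {measure set T -> \bar R}) (P' : {measure set T' -> \bar R}).
Variables (X : T -> nat) (X' : T' -> nat) (D : set T) (D' : set T') (r : R).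
Hypotheses (mX : measurable_fun setT X) (mX' : measurable_fun setT X').
Hypotheses (r0 : 0 <= r) (mD : measurable D) (mD' : measurable D').
Hypothesis PP' : forall n,
  P (D `&` X @^-1` [set n]) = (r%:E * P' (D' `&` X' @^-1` [set n]))%E.

(** Both integrals are series over the values of the variables, and [PP'] compares them term by
    term. The factor [r] will be 1 for equal laws, and a conditional probability when the event is
    shrunk. *)
Lemma ge0_integral_nat_valued_scale (g : nat -> \bar R) : (forall n, 0 <= g n)%E ->
  (\int[P]_(w in D) g (X w) = r%:E * \int[P']_(w in D') g (X' w))%E.
Proof.
move=> g0; rewrite !ge0_integral_nat_valued// -nneseriesZl; last first.
  by move=> n _; rewrite mule_ge0.
by apply: eq_eseriesr => n _; rewrite PP' muleCA.
Qed.

Lemma integrable_nat_valued (g : nat -> \bar R) :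
  P'.-integrable D' (g \o X') -> P.-integrable D (g \o X).
Proof.
move=> /integrableP[_ goo]; apply/integrableP; split.
  exact: measurable_nat_comp mX.
rewrite (ge0_integral_nat_valued_scale (g := fun n => `|g n|%E))//.
by apply: lte_mul_pinfty => //; rewrite lee_fin.
Qed.

Lemma integral_nat_valued (g : nat -> \bar R) : P'.-integrable D' (g \o X') ->
  (\int[P]_(w in D) g (X w) = r%:E * \int[P']_(w in D') g (X' w))%E.
Proof.
move=> ig; rewrite -[LHS]/(\int[P]_(w in D) (g \o X) w)%E.
rewrite -[X in _ = (_ * X)%E]/(\int[P']_(w in D') (g \o X') w)%E.
rewrite integralE [in RHS]integralE (funepos_comp g X).
  rewrite (funepos_comp g X') (funeneg_comp g X) (funeneg_comp g X') muleBr//.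
  by congr (_ - _)%E; apply: ge0_integral_nat_valued_scale.
rewrite -funepos_comp -funeneg_comp; apply: fin_num_adde_defr.
by apply: integrable_fin_num => //; exact: integrable_funepos.
Qed.

End scale.
End nat_valued.

Section probability_values.
Context {R : realType} d (T : measurableType d) (P : probability T R).

Definition pr (A : set T) : R := fine (P A).

Lemma prE A : measurable A -> P A = (pr A)%:E.
Proof. by move=> mA; rewrite fineK// fin_num_measure. Qed.

Lemma pr_ge0 A : 0 <= pr A.
Proof. exact: fine_ge0. Qed.

Lemma le_pr A B : measurable A -> measurable B -> A `<=` B -> pr A <= pr B.
Proof.
move=> mA mB AB; rewrite -lee_fin -!prE//.
by apply: le_measure => //; rewrite inE.
Qed.

Lemma pr_sub0 A B : measurable A -> measurable B -> A `<=` B ->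
  pr B = 0 -> pr A = 0.
Proof.
move=> mA mB AB B0; apply/eqP; rewrite eq_le pr_ge0 andbT -B0.
exact: le_pr.
Qed.

End probability_values.

(** * Conditional independence from (F_4) *)

Section conditional_expectation_indic.
Context {R : realType} d (T : measurableType d) (P : probability T R).
Variables (G : set (set T)) (Y : T -> nat).
Hypothesis GY : forall A, G A <-> exists B, A = Y @^-1` B.
Hypothesis mG : G `<=` measurable.

Let mY : measurable_fun setT Y.
Proof.
by apply: measurable_nat_valued => n; apply/mG/GY; exists [set n].
Qed.

Lemma is_cond_expectation_indic_id A : G A -> is_cond_expectation P G \1_A \1_A.
Proof.
move=> GA; have iA : P.-integrable setT (EFin \o \1_A).
  by apply: integrable_indic => //; exact: mG.
split => // _ [C mC <-]; rewrite setTI.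
have /GY[B ->] := GA; apply/GY.
exists ((\1_B : nat -> R) @^-1` C).
by rewrite -[RHS]comp_preimage; congr (_ @^-1` _); apply/funext => w.
Qed.

(** An explicit version: [h n] is the elementary conditional probability of [A] given the atom where
    [Y] equals [n]. *)
Lemma ex_is_cond_expectation_indic A : measurable A ->
  exists h : nat -> R, is_cond_expectation P G \1_A (h \o Y).
Proof.
move=> mA; pose p n := pr P (Y @^-1` [set n]).
pose h n := pr P (A `&` Y @^-1` [set n]) / p n.
have mYB B : measurable (Y @^-1` B) by exact: measurable_nat_preimage.
have h0 n : 0 <= h n by rewrite divr_ge0// pr_ge0.
have hE B : (\int[P]_(w in Y @^-1` B) (h (Y w))%:E = P (A `&` Y @^-1` B))%E.
  rewrite (ge0_integral_nat_valued _ (g := EFin \o h))//.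
  rewrite [RHS](@measure_nat_valued _ _ _ _ Y)//; last exact: measurableI.
  apply: eq_eseriesr => n _ /=.
  have [Bn|Bn] := pselect (B n); last first.
    have BY0 : Y @^-1` B `&` Y @^-1` [set n] = set0.
      by apply/seteqP; split=> // w [/= + /= wn]; rewrite wn.
    by rewrite -setIA BY0 setI0 !measure0 mule0.
  rewrite -setIA (_ : Y @^-1` B `&` _ = Y @^-1` [set n]); last first.
    by apply/seteqP; split=> [w []//|w /= ->].
  rewrite !prE//; last exact: measurableI.
  rewrite -EFinM; congr EFin; rewrite /h/p.
  (* On a null atom both sides vanish, since the part of [A] inside it is null too. *)
  have [p0|p0] := eqVneq (pr P (Y @^-1` [set n])) 0; last by rewrite divfK.
  rewrite p0 mulr0; apply/esym; apply: pr_sub0 p0 => //; exact: measurableI.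
exists h; split.
- exact: integrable_indic.
- apply/integrableP; split.
    by apply/measurable_realfun.measurable_EFinP; exact: measurable_nat_comp mY.
  rewrite (_ : (\int[P]_x _)%E = P A); first by rewrite prE ?ltry.
  have := hE setT; rewrite preimage_setT setIT => <-.
  by apply: eq_integral => w _; rewrite /= ger0_norm.
- move=> _ [C mC <-]; rewrite setTI; apply/GY.
  by exists (h @^-1` C); rewrite comp_preimage.
- move=> C /[dup] GC /GY[B CE]; rewrite integral_indic//; last exact: mG.
  by rewrite CE hE.
Qed.

End conditional_expectation_indic.

Section F4_event.
Context {R : realType} d (T : measurableType d) (P : probability T R).
Context (N M : nat) (F : 'I_N -> 'I_M -> set (set T)).
Variable Y : 'I_N -> 'I_M -> T -> nat.
Hypothesis FY : forall i j A, F i j A <-> exists B, A = Y i j @^-1` B.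
Hypothesis mF : forall i j, F i j `<=` measurable.
Hypothesis hF4 : F4_condition P F.

(* Conditional independence of F_{i,j} and F_{i',j'} on D, which is an atom of
   F_{min,min} or is empty. *)
Lemma F4_cond_indep i i' j j' (A B D : set T) n :
  let i0 := Order.min i i' in let j0 := Order.min j j' in
  F i j A -> F i' j' B -> F i' j' D -> F i0 j0 D -> D `<=` Y i0 j0 @^-1` [set n] ->
  pr P (A `&` (B `&` D)) * pr P D = pr P (A `&` D) * pr P (B `&` D).
Proof.
move=> i0 j0 FA FB FD' FD Dn.
have mA := mF FA; have mB := mF FB; have mD := mF FD.
have [h hh] := ex_is_cond_expectation_indic P (@FY i' j') (@mF i' j') mA.
have [k hk] := ex_is_cond_expectation_indic P (@FY i0 j0) (@mF i0 j0) mA.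
(* The indicator of [A] is its own conditional expectation given [F i j], so (F_4) says that its
   conditional expectations given [F i' j'] and given [F i0 j0] coincide almost surely. The latter
   is the constant [k n] on [D]. *)
have hkE := hF4 (is_cond_expectation_indic_id P (@FY i j) (@mF i j) FA) hh hk.
have kE C : measurable C -> C `<=` D ->
    (\int[P]_(w in C) (k (Y i0 j0 w))%:E = (k n)%:E * P C)%E.
  move=> mC CD; rewrite -integral_cst//; apply: eq_integral => w.
  by rewrite inE => /CD/Dn /= ->.
have FBD : F i' j' (B `&` D).
  have /FY[B1 ->] := FB; have /FY[B2 ->] := FD'.
  by apply/FY; exists (B1 `&` B2).
have mBD := mF FBD.
have H1 : pr P (A `&` (B `&` D)) = k n * pr P (B `&` D).
  apply/EFin_inj; rewrite EFinM -!prE//; last exact: measurableI.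
  rewrite -(kE _ mBD); last exact: subIsetr.
  have ih : P.-integrable setT (EFin \o (h \o Y i' j')) by case: hh.
  have ik : P.-integrable setT (EFin \o (k \o Y i0 j0)) by case: hk.
  transitivity (\int[P]_(w in B `&` D) (h (Y i' j' w))%:E)%E.
    by case: hh => _ _ _ /(_ _ FBD) ->; rewrite integral_indic.
  apply: ae_eq_integral => //.
  - apply: (@measurable_funS _ _ _ _ setT) => //; exact: measurable_int ih.
  - apply: (@measurable_funS _ _ _ _ setT) => //; exact: measurable_int ik.
  - by apply: filterS hkE => w /= <-.
have H2 : pr P (A `&` D) = k n * pr P D.
  apply/EFin_inj; rewrite EFinM -!prE//; last exact: measurableI.
  rewrite -(kE _ mD)//.
  by case: hk => _ _ _ /(_ _ FD) ->; rewrite integral_indic.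
by rewrite H1 H2 mulrAC.
Qed.

End F4_event.

(** * Finite product measures *)

Section product_probability.
Context {R : realType} d1 d2 (T1 : measurableType d1) (T2 : measurableType d2).
Variables (P1 : probability T1 R) (P2 : probability T2 R).
Local Open Scope ereal_scope.

Definition product_probability : set (T1 * T2) -> \bar R := P1 \x P2.

HB.instance Definition _ := Measure.on product_probability.

Let product_probability_setT : product_probability setT = 1.
Proof.
rewrite -setXTT /product_probability product_measure1E// -(mule1 1).
by congr (_ * _); exact: probability_setT.
Qed.

HB.instance Definition _ :=
  Measure_isProbability.Build _ _ _ product_probability product_probability_setT.

End product_probability.

Section boxes.
Context {I : finType} {d : I -> measure_display}.
Variable S : forall k, measurableType (d k).

Definition box (A : forall k, set (S k)) : set (prod_space S) :=
  [set s | forall k, A k (s k)].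

Lemma measurable_prod_space_coord k : measurable_fun setT (prod_space_coord S k).
Proof.
move=> _ B mB; apply: sub_sigma_algebra; exists k => //; exists B => //.
Qed.

Lemma measurable_box A : (forall k, measurable (A k)) -> measurable (box A).
Proof.
move=> mA.
rewrite (_ : box A = \bigcap_(k in [set: I]) (prod_space_coord S k) @^-1` (A k)).
  apply: fin_bigcap_measurable => // k _; rewrite -[X in measurable X]setTI.
  exact: measurable_prod_space_coord.
by apply/seteqP; split=> [s As k _|s As k]; [exact: As|exact: As].
Qed.

Lemma boxI A B : box A `&` box B = box (fun k => A k `&` B k).
Proof.
apply/seteqP; split=> [s [As Bs] k|s ABs]; first by split; [exact: As|exact: Bs].
by split => k; have [] := ABs k.
Qed.

Lemma measurable_fun_prod_space d' (T : measurableType d') (f : T -> prod_space S) :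
  (forall k, measurable_fun setT (fun t => f t k)) -> measurable_fun setT f.
Proof.
move=> mf; apply: (measurability (prod_space_cylinders S)) => //.
move=> _ [_ [k _ [B mB <-]] <-].
by rewrite !setTI -[X in measurable X]setTI; exact: mf.
Qed.

Definition measurable_boxes : set (set (prod_space S)) :=
  [set E | exists2 A, (forall k, measurable (A k)) & E = box A].

(** A cylinder is a box with at most one restricted side, and a box is a finite intersection of
    cylinders. *)
Lemma measurable_boxesE : measurable = <<s measurable_boxes >>.
Proof.
apply/seteqP; split; last first.
  apply: smallest_sub; first exact: sigma_algebra_measurable.
  by move=> _ [A mA ->]; exact: measurable_box.
apply: sub_sigma_algebra2 => _ [k _ [B mB <-]].
exists (dfwith (fun j => [set: S j]) k B) => [j|]; first by case: dfwithP.
rewrite setTI; apply/seteqP; split=> [s Bs j|s /(_ k)]; first by case: dfwithP.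
by rewrite dfwithin.
Qed.

Lemma setI_closed_measurable_boxes : setI_closed measurable_boxes.
Proof.
move=> _ _ [A mA ->] [B mB ->]; exists (fun k => A k `&` B k); last exact: boxI.
by move=> k; exact: measurableI.
Qed.

Lemma box_setT : box (fun k => [set: S k]) = setT.
Proof. by apply/seteqP; split. Qed.

Lemma measure_boxes_unique (R : realType)
    (m1 m2 : {measure set (prod_space S) -> \bar R}) :
  (m1 setT < +oo)%E ->
  (forall A, (forall k, measurable (A k)) -> m1 (box A) = m2 (box A)) ->
  forall E, measurable E -> m1 E = m2 E.
Proof.
move=> m1oo m12; apply: (measure_unique measurable_boxes (fun=> setT)) => //.
- exact: measurable_boxesE.
- exact: setI_closed_measurable_boxes.
- by move=> _; exists (fun k => [set: S k]) => //; rewrite box_setT.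
- by rewrite bigcup_const//; exists 0%N.
- by move=> _ [A mA ->]; exact: m12.
Qed.

End boxes.

(** Coordinates are made random one at a time: those in the list [l] follow [mu], the others are
    frozen at a base point by Dirac masses. A new coordinate [k] is added by pushing the product of
    [mu k] and [nu] forward along the map that overwrites the [k]-th coordinate. *)
Lemma ex_product_probability (R : realType) (I : finType) (d : I -> measure_display)
    (S : forall k, measurableType (d k)) (mu : forall k, probability (S k) R) :
  exists nu : probability (prod_space S) R, is_product_probability mu nu.
Proof.
pose pt : prod_space S := fun k => point.
pose m (l : seq I) k : probability (S k) R :=
  if k \in l then mu k else dirac (pt k).
suff [nu nuE] : exists nu : probability (prod_space S) R,
    is_product_probability (m (enum I)) nu.
  exists nu => A mA; rewrite nuE//; apply: eq_bigr => k _.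
  by rewrite /m mem_enum.
elim: (enum I) => [|k l [nu nuE]].
  exists (dirac pt) => A mA; rewrite [LHS]diracE.
  have [Apt|Apt] := pselect (forall k, A k (pt k)).
    rewrite mem_set// big1// => k _.
    by rewrite /m /= [LHS]diracE mem_set.
  rewrite memNset//; have /existsNP[k Ak] := Apt.
  by rewrite (bigD1 k)//= /m/= [X in (X * _)%E]diracE memNset// mul0e.
have [kl|kl] := boolP (k \in l).
  exists nu => A mA; rewrite nuE//; apply: eq_bigr => j _.
  by rewrite /m inE; case: eqVneq => //= ->; rewrite kl.
pose upd (p : S k * prod_space S) : prod_space S := dfwith p.2 k p.1.
have mupd : measurable_fun setT upd.
  apply: measurable_fun_prod_space => j.
  have [kj|kj] := eqVneq k j.
    move: j kj => _ <-.
    rewrite (_ : (fun _ => _) = fst); first exact: measurable_fst.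
    by apply/funext => p; rewrite /upd dfwithin.
  rewrite (_ : (fun _ => _) = prod_space_coord S j \o snd).
    apply: measurableT_comp; last exact: measurable_snd.
    exact: measurable_prod_space_coord.
  by apply/funext => p; rewrite /upd dfwithout.
pose X := MeasurableFun.Pack
  (MeasurableFun.Class (isMeasurableFun.Build _ _ _ _ _ mupd)).
exists (distribution (product_probability (mu k) nu) X) => A mA.
rewrite /distribution /pushforward /=.
(* The old [k]-th coordinate is discarded, so its side becomes the full space. *)
rewrite (_ : _ @^-1` _ = A k `*` box (dfwith A k setT)).
  rewrite /product_probability product_measure1E//; last first.
    by apply: measurable_box => j; case: dfwithP.
  have mk : m (k :: l) k = mu k by rewrite /m mem_head.
  rewrite [in RHS](bigD1 k)//= mk; congr (_ * _)%E.
  rewrite [LHS]nuE; last by move=> j; case: dfwithP.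
  rewrite (bigD1 k)//= dfwithin probability_setT mul1e.
  apply: eq_bigr => j jk; rewrite dfwithout 1?eq_sym//.
  by rewrite /m inE (negbTE jk).
apply/seteqP; split=> [[x s] /= H|[x s] [/= Ax As] j].
  split; first by have := H k; rewrite /upd dfwithin.
  by move=> j /=; case: dfwithP => // i ki; have := H i; rewrite /upd dfwithout.
by rewrite /upd/=; case: dfwithP => //= i ki; have := As i; rewrite dfwithout.
Qed.

(** * Independence of disjoint groups of coordinates *)

Section product_independence.
Context {R : realType} {I : finType} {d : I -> measure_display}.
Context (S : forall k, measurableType (d k)).
Variables (mu : forall k, probability (S k) R) (nu : probability (prod_space S) R).
Hypothesis hnu : is_product_probability mu nu.
Variable D : pred I.

Lemma measurable_prod_space_proj : measurable_fun setT (prod_space_proj S D).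
Proof.
apply: measurable_fun_prod_space => k.
exact: (@measurable_prod_space_coord _ _ S (sval k)).
Qed.

(** This handles the sides of boxes that are restricted only for some coordinates. [B] may depend on
    the proof of [b], as for sides indexed by a subtype of the coordinates. *)
Lemma measurable_guard (k : I) (b : Prop) (B : b -> set (S k)) :
  (forall p, measurable (B p)) -> measurable [set x | forall p, B p x].
Proof.
move=> mB; have [p|nb] := pselect b.
  rewrite (_ : [set x | _] = B p)//; apply/seteqP; split=> [x|x Bx q]; first exact.
  by rewrite (Prop_irrelevance q p).
rewrite (_ : [set x | _] = setT)//.
by apply/seteqP; split=> // x _ p; exfalso.
Qed.

(** With [A] the preimage of [C], both sides are finite measures in [C], so it suffices to take [C]
    a box. Then all the events are boxes, and each coordinate is restricted by only one of [A] and
    [O]. *)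
Lemma product_probability_indep A B :
  g_sigma_algebra_preimage (prod_space_proj S D) A ->
  (forall k, measurable (B k)) ->
  let O := box (fun k => [set x | ~~ D k -> B k x]) in
  (nu (A `&` O) = nu A * nu O)%E.
Proof.
move=> [C mC <-] mB O; rewrite setTI.
pose B1 k := [set x | ~~ D k -> B k x].
have mB1 k : measurable (B1 k) by apply: (@measurable_guard k (~~ D k) (fun=> B k)).
have mO : measurable O by exact: measurable_box.
have mp := measurable_prod_space_proj.
pose p := prod_space_proj S D.
have O0 : 0 <= fine (nu O) by exact: fine_ge0.
pose m1 : {measure set _ -> \bar R} := pushforward (mrestr nu mO) p.
pose m2 : {measure set _ -> \bar R} := mscale (NngNum O0) (pushforward nu p).
suff -> : nu (prod_space_proj S D @^-1` C `&` O) = m2 mp C.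
  by rewrite /m2 /= /mscale /= fineK ?fin_num_measure// muleC.
rewrite -[LHS]/(m1 mp C).
apply: measure_boxes_unique mC.
  rewrite /m1/= /pushforward/= /mrestr preimage_setT setTI.
  by rewrite (le_lt_trans (probability_le1 _ _))// ltry.
move=> {}A mA.
rewrite /m1/= /pushforward/= /mrestr /m2 /= /mscale /= fineK ?fin_num_measure//.
pose A1 k := [set x : S k | forall q : D k, A (exist _ k q) x].
have mA1 k : measurable (A1 k).
  by apply: (@measurable_guard k (D k) (fun q => A (exist _ k q))) => q; exact: mA.
rewrite /pushforward (_ : _ @^-1` box A = box A1); last first.
  apply/seteqP; split=> [s As k q|s As [k q]]; last exact: As.
  exact: (As (exist _ k q)).
rewrite boxI.
rewrite [LHS]hnu; last by move=> k; exact: measurableI.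
rewrite muleC [X in (X * _)%E]hnu// [X in (_ * X)%E]hnu//.
rewrite -big_split /=; apply: eq_bigr => k _.
have [Dk|Dk] := boolP (D k).
  have -> : [set x : S k | ~~ true -> B k x] = setT by apply/seteqP; split.
  by rewrite setIT probability_setT mule1.
have -> : A1 k = setT.
  by apply/seteqP; split => // x _ q; exfalso; exact: (negP Dk).
by rewrite setTI probability_setT mul1e.
Qed.

End product_independence.

(** * Quantile functions *)

Section quantile.
Context {R : realType}.

Lemma uniform_prob_itvco (a b : R) : 0 <= a -> a <= b -> b <= 1 ->
  uniform_prob ltr01 `[a, b[%classic = (b - a)%:E.
Proof.
move=> a0 ab b1; rewrite /uniform_prob.
rewrite (eq_integral (fun=> 1%:E)); last first.
  move=> x; rewrite inE/= in_itv/= => /andP[ax xb].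
  by rewrite /uniform_pdf (le_trans a0 ax) (le_trans (ltW xb) b1) subr0 invr1.
rewrite integral_cst//= mul1e lebesgue_measure_itv/= lte_fin.
have [//|ba] := ltP a b.
have -> : a = b by apply/eqP; rewrite eq_le ab ba.
by rewrite subrr.
Qed.

(** The partial sums [c n] cut the unit interval into consecutive intervals [J n] of lengths [w n],
    and [q] equals [n] on [J n]. *)
Lemma ex_quantile (w : nat -> R) : (forall n, 0 <= w n) ->
  (\sum_(0 <= n <oo) (w n)%:E = 1)%E ->
  exists q : measurableTypeR R -> nat, measurable_fun setT q /\
    forall n, uniform_prob ltr01 (q @^-1` [set n]) = (w n)%:E.
Proof.
move=> w0 w1; pose c n := \sum_(0 <= k < n) w k.
have cS n : c n.+1 = c n + w n by rewrite /c big_nat_recr.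
have cle m n : (m <= n)%N -> c m <= c n.
  elim: n => [|n IH]; first by rewrite leqn0 => /eqP ->.
  rewrite leq_eqVlt => /predU1P[->//|]; rewrite ltnS => /IH /le_trans; apply.
  by rewrite cS lerDl.
have c0 n : 0 <= c n by apply: sumr_ge0 => k _.
have c1 n : c n <= 1.
  rewrite -lee_fin -w1 /c -sumEFin.
  by apply: nneseries_lim_ge => k _ _; rewrite lee_fin.
pose J n : set R := `[c n, c n.+1[%classic.
have JE m n u : J m u -> J n u -> m = n.
  rewrite /J /= !in_itv /= => /andP[mu um] /andP[nu un].
  have [mn|nm|//] := ltngtP m n.
    by have := le_lt_trans (le_trans (cle _ _ mn) nu) um; rewrite ltxx.
  by have := le_lt_trans (le_trans (cle _ _ nm) mu) un; rewrite ltxx.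
(* The half-open intervals [J n] cover [0, 1) only; [q] is 0 elsewhere. *)
pose q u := xget 0%N [set n | J n u].
have qJ n u : J n u -> q u = n.
  by move=> Jnu; rewrite /q; case: xgetP => [m _ /JE|/(_ n)//]; exact.
have qS n : q @^-1` [set n.+1] = J n.+1.
  apply/seteqP; split => [u /=|u /qJ//]; rewrite /q.
  by case: xgetP => [m _ /= Jm <-//|_].
have mJ n : measurable (J n : set (measurableTypeR R)) by exact: measurable_itv.
have mq : measurable_fun setT (q : measurableTypeR R -> nat).
  apply: measurable_nat_valued => -[|n]; last by rewrite qS.
  rewrite (_ : _ @^-1` _ = ~` \bigcup_n (J n.+1)).
    by apply/measurableC/bigcup_measurable => n _; exact: mJ.
  apply/seteqP; split => [u /= qu [n _ /qJ]|u Ju /=]; first by rewrite qu.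
  case qn : (q u) => [//|n]; exfalso; apply: Ju; exists n => //.
  by rewrite -qS.
have US n : uniform_prob ltr01 (q @^-1` [set n.+1]) = (w n.+1)%:E.
  by rewrite qS uniform_prob_itvco// (cS n.+1) ?lerDl// addrAC subrr add0r.
exists q; split => // -[|n]; last exact: US.
(* The fibre of [q] over 0 also contains the points outside all the intervals. Its mass is found by
   subtracting the masses of the other fibres from 1. *)
pose rest := (\sum_(0 <= n <oo) (w n.+1)%:E)%E.
have rest0 : (0 <= rest)%E by apply: nneseries_ge0 => n _ _; rewrite lee_fin.
have wE : ((w 0)%:E + rest = 1)%E.
  rewrite -w1 [RHS]nneseries_recl//; last by move=> n _; rewrite lee_fin.
  rewrite -nneseries_addn; last by move=> n; rewrite lee_fin.
  by congr (_ + _)%E; apply: eq_eseriesr => n _; rewrite addn1.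
have uE : (uniform_prob ltr01 (q @^-1` [set 0%N]) + rest = 1)%E.
  rewrite -(probability_setT (uniform_prob (@ltr01 R))).
  rewrite (measure_nat_valued (uniform_prob (@ltr01 R)) measurableT mq).
  rewrite nneseries_recl// -nneseries_addn// setTI; congr (_ + _)%E.
  by apply: eq_eseriesr => n _; rewrite setTI addn1; exact/esym/US.
have restfin : rest \is a fin_num.
  by rewrite ge0_fin_numE// (@le_lt_trans _ _ 1%E) ?ltry// -wE leeDr// lee_fin.
by rewrite -(addeK (uniform_prob ltr01 _) restfin) uE -wE addeK.
Qed.

End quantile.

(** * Simulating a family from independent coordinates *)

Section configurations.
Context {I : finType}.
Implicit Types (D : pred I) (x y : {ffun I -> nat}).

Definition cyl (T : Type) (Y : T -> {ffun I -> nat}) D x : set T :=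
  [set w | forall q, D q -> Y w q = x q].

Definition agree D x y := forall q, D q -> x q = y q.

(** A canonical representative of the configurations that agree with [x] on [D]: it turns agreement
    into equality. *)
Definition restr D x : {ffun I -> nat} := [ffun q => if D q then x q else 0%N].

Lemma eq_restr D x y : restr D x = restr D y <-> agree D x y.
Proof.
split=> [/ffunP xy q Dq|xy]; first by have := xy q; rewrite !ffunE Dq.
by apply/ffunP => q; rewrite !ffunE; case: ifP => // /xy.
Qed.

Lemma cyl_agree (T : Type) (Y : T -> {ffun I -> nat}) D x y :
  agree D x y -> cyl Y D x = cyl Y D y.
Proof.
by move=> xy; apply/seteqP; split=> w Yx q Dq; rewrite Yx// xy.
Qed.

Lemma measurable_cyl d (T : measurableType d) (Y : T -> {ffun I -> nat}) D x :
  (forall q, measurable_fun setT (fun w => Y w q)) -> measurable (cyl Y D x).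
Proof.
move=> mY; rewrite (_ : cyl Y D x =
  \bigcap_(q in [set q | D q]) ((fun w => Y w q) @^-1` [set x q])).
  by apply: fin_bigcap_measurable => // q _; exact: measurable_nat_preimage.
by apply/seteqP; split=> w Yx q /Yx.
Qed.

End configurations.

Section transition.
Context {R : realType} {I : finType} (le : rel I) (rank : I -> nat).
Hypothesis rank_inj : injective rank.
Hypothesis le_rank : forall q p, le q p -> q != p -> (rank q < rank p)%N.

Definition slt q p := le q p && (q != p).

Context d (T : measurableType d) (P : probability T R) (Y : T -> {ffun I -> nat}).
Hypothesis mY : forall q, measurable_fun setT (fun w => Y w q).

(* On a null conditioning event this is the Dirac mass at 0, so that it is a
   probability on nat in all cases. *)
Definition transition p x n : R :=
  if pr P (cyl Y (slt^~ p) x) == 0 then (n == 0%N)%:R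
  else pr P (cyl Y (slt^~ p) x `&` [set w | Y w p = n]) / pr P (cyl Y (slt^~ p) x).

Lemma transition_ge0 p x n : 0 <= transition p x n.
Proof.
by rewrite /transition; case: ifP => _; rewrite ?ler0n// divr_ge0// pr_ge0.
Qed.

Lemma transition_sum p x : (\sum_(0 <= n <oo) (transition p x n)%:E = 1)%E.
Proof.
have mC : measurable (cyl Y (slt^~ p) x) by exact: measurable_cyl.
rewrite /transition; case: eqP => [_|/eqP C0].
  rewrite nneseries_recl//= -nneseries_addn//.
  by rewrite eseries0 ?adde0// => n _ _; rewrite addn1.
rewrite (eq_eseriesr (g := fun n => ((pr P (cyl Y (slt^~ p) x))^-1)%:E *
  P (cyl Y (slt^~ p) x `&` (fun w => Y w p) @^-1` [set n]))%E); last first.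
  move=> n _; rewrite EFinM muleC; congr (_ * _)%E; apply/esym/prE.
  by apply: measurableI => //; exact: measurable_nat_preimage.
rewrite nneseriesZl; last by move=> n _; exact: measure_ge0.
rewrite -measure_nat_valued//.
transitivity ((pr P (cyl Y (slt^~ p) x))^-1%:E * (pr P (cyl Y (slt^~ p) x))%:E)%E;
  last by rewrite -EFinM mulVf.
by congr (_ * _)%E; exact: prE.
Qed.

Lemma transition_agree p x y :
  agree (slt^~ p) x y -> transition p x = transition p y.
Proof. by move=> xy; rewrite /transition (cyl_agree _ xy). Qed.

(** The law of coordinate [p] given all coordinates of smaller rank is its law given those strictly
    below [p]. Denominators are cleared so that null events are included. *)
Hypothesis markov : forall p x,
  let A := cyl Y (fun q => rank q < rank p)%N x in
  let V := cyl Y (slt^~ p) x in let C := [set w | Y w p = x p] in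
  pr P (A `&` C) * pr P V = pr P A * pr P (V `&` C).

(** Induction on [n]: by injectivity of [rank] at most one coordinate [p] is added, and [markov]
    identifies its conditional law with [transition p]. *)
Lemma chain_rule x n :
  pr P (cyl Y (fun q => rank q < n)%N x) =
  \prod_(q | (rank q < n)%N) transition q x (x q).
Proof.
elim: n => [|n IH].
  rewrite big_pred0// (_ : cyl _ _ _ = setT); last by apply/seteqP; split.
  by rewrite /pr probability_setT.
have [[p pn]|np] := pselect (exists p, rank p = n); last first.
  have eqn q : (rank q < n.+1)%N = (rank q < n)%N.
    rewrite ltnS leq_eqVlt; case: eqP => // qn.
    by exfalso; apply: np; exists q.
  rewrite (eq_bigl _ _ eqn) -IH; congr pr.
  by apply/seteqP; split=> w Yx q; move: (Yx q); rewrite eqn.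
have eqn q : (rank q < n.+1)%N = (q == p) || (rank q < n)%N.
  by rewrite ltnS leq_eqVlt -pn (inj_eq rank_inj).
have mC D : measurable (cyl Y D x) by exact: measurable_cyl.
have mCp : measurable [set w | Y w p = x p].
  exact: (measurable_nat_preimage [set x p] (mY p)).
rewrite (bigD1 p) ?eqn ?eqxx//=.
rewrite (eq_bigl (fun q => (rank q < n)%N)); last first.
  by move=> q; rewrite eqn; case: eqVneq => [->|_] /=; rewrite ?andbT// pn ltnn.
rewrite -IH.
have -> : cyl Y (fun q => rank q < n.+1)%N x =
    cyl Y (fun q => rank q < n)%N x `&` [set w | Y w p = x p].
  apply/seteqP; split=> [w Yx|w [Yx Yp] q].
    by split=> [q qn|]; apply: Yx; rewrite eqn ?qn ?orbT// eqxx.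
  by rewrite eqn => /predU1P[->//|]; exact: Yx.
have AV : cyl Y (fun q => rank q < n)%N x `<=` cyl Y (slt^~ p) x.
  by move=> w Yx q /andP[qp qNp]; apply: Yx; rewrite -pn le_rank.
(* If the conditioning event is null, so is the smaller event that fixes all coordinates of smaller
   rank, and both sides are 0. *)
rewrite /transition; case: eqP => [V0|/eqP V0].
  rewrite (@pr_sub0 _ _ _ P _ (cyl Y (slt^~ p) x))//; last 2 first.
  - exact: measurableI.
  - by move=> w [/AV].
  by rewrite [X in _ * X](@pr_sub0 _ _ _ P _ (cyl Y (slt^~ p) x))// mulr0.
have := markov p x; rewrite /= pn => /(canRL (mulfK V0)) ->.
by rewrite -mulrA mulrC.
Qed.

Lemma joint_law x : pr P [set w | Y w = x] = \prod_q transition q x (x q).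
Proof.
have rmax q : (rank q < (\max_q rank q).+1)%N by rewrite ltnS leq_bigmax.
transitivity (\prod_(q | (rank q < (\max_q rank q).+1)%N) transition q x (x q)).
  rewrite -chain_rule; congr pr.
  apply/seteqP; split=> [w /= Yx q _|w Yx]; first by rewrite Yx.
  by apply/ffunP => q; exact: Yx.
by apply: eq_bigl => q; rewrite rmax.
Qed.

End transition.

(** * Realization on a product space *)

Section realization.
Context {R : realType} {I : finType} (le : rel I) (rank : I -> nat).
Hypothesis le_refl : reflexive le.
Hypothesis le_trans : transitive le.
Hypothesis rank_inj : injective rank.
Hypothesis le_rank : forall q p, le q p -> q != p -> (rank q < rank p)%N.

Context d (T : measurableType d) (P : probability T R) (Y : T -> {ffun I -> nat}).
Hypothesis mY : forall q, measurable_fun setT (fun w => Y w q).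
Hypothesis markov : forall p x,
  let A := cyl Y (fun q => rank q < rank p)%N x in
  let V := cyl Y (slt le ^~ p) x in let C := [set w | Y w p = x p] in
  pr P (A `&` C) * pr P V = pr P A * pr P (V `&` C).

Context dU (U : measurableType dU) (lam : probability U R).
(** The source of randomness is kept abstract: all that is asked is that every law on [nat] be an
    image of [lam]. *)
Hypothesis quantile : forall w : nat -> R, (forall n, 0 <= w n) ->
  (\sum_(0 <= n <oo) (w n)%:E = 1)%E ->
  exists q : U -> nat, measurable_fun setT q /\
    forall n, lam (q @^-1` [set n]) = (w n)%:E.

Local Notation S := (fun _ : I => U).
Variable nu : probability (prod_space S) R.
Hypothesis hnu : is_product_probability (fun=> lam) nu.

Lemma ex_transition_map : exists Q : I -> {ffun I -> nat} -> U -> nat,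
  [/\ forall p x, measurable_fun setT (Q p x),
      forall p x y, agree (slt le ^~ p) x y -> Q p x = Q p y &
      forall p x n, lam (Q p x @^-1` [set n]) = (transition le P Y p x n)%:E].
Proof.
have H (px : I * {ffun I -> nat}) := quantile
  (transition_ge0 le P Y px.1 px.2) (transition_sum le P mY px.1 px.2).
have [Q QP] := choice H.
(* Choosing the quantile function at [restr] makes it depend only on the coordinates strictly below
   [p]; its law is unchanged, because [transition] depends only on them as well. *)
exists (fun p x => Q (p, restr (slt le ^~ p) x)); split=> [p x|p x y|p x n].
- by have [] := QP (p, restr (slt le ^~ p) x).
- by move=> /eq_restr ->.
- have [_ ->] := QP (p, restr (slt le ^~ p) x); congr EFin.
  rewrite (@transition_agree _ _ _ _ _ _ _ _ _ x)// => q qp.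
  by rewrite ffunE qp.
Qed.

Section fixpoint.
Variable Q : I -> {ffun I -> nat} -> U -> nat.
Hypothesis Qagree : forall p x y, agree (slt le ^~ p) x y -> Q p x = Q p y.

(* One step fixes the coordinates of the next rank, so enough steps from an
   arbitrary start reach the unique fixpoint. *)
Definition trajectory_step (s : prod_space S) x : {ffun I -> nat} :=
  [ffun p => Q p x (s p)].

Definition trajectory (s : prod_space S) : {ffun I -> nat} :=
  iter (\max_p rank p).+1 (trajectory_step s) [ffun=> 0%N].

Lemma iter_trajectory_step s n x y p : (rank p < n)%N ->
  iter n (trajectory_step s) x p = iter n (trajectory_step s) y p.
Proof.
elim: n p => // n IH p pn /=; rewrite !ffunE.
rewrite (@Qagree _ _ (iter n (trajectory_step s) y))//.
move=> q /andP[qp qNp]; apply: IH.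
by rewrite -ltnS (leq_trans _ pn)// ltnS le_rank.
Qed.

Lemma trajectoryE s p : trajectory s p = Q p (trajectory s) (s p).
Proof.
rewrite -[RHS](ffunE (fun p => Q p (trajectory s) (s p))).
(* One more step at the end is one more step at the start, and the starting point has been forgotten
   after this many steps. *)
transitivity (iter (\max_p rank p).+1 (trajectory_step s)
    (trajectory_step s [ffun=> 0%N]) p); last by rewrite -iterSr.
by apply: iter_trajectory_step; rewrite ltnS leq_bigmax.
Qed.

(** Since [D] is closed downwards, the value at [q] in [D] is computed from values that are already
    prescribed by [x]. The condition at [q] therefore concerns [s q] alone; the converse is by
    induction on the rank. *)
Lemma cyl_trajectory (D : pred I) x : (forall q p, le q p -> D p -> D q) ->
  cyl trajectory D x = box (fun q => [set u : U | D q -> Q q x u = x q]).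
Proof.
move=> Ddown; apply/seteqP; split=> [s Xx q Dq|s sx].
  have <- : Q q (trajectory s) = Q q x.
    by apply: Qagree => r /andP[rq _]; rewrite Xx//; exact: Ddown Dq.
  by rewrite -trajectoryE Xx.
suff H n q : (rank q < n)%N -> D q -> trajectory s q = x q.
  by move=> q; exact: (H (rank q).+1).
elim: n q => // n IH q qn Dq; rewrite trajectoryE -[RHS](sx q Dq).
suff -> : Q q (trajectory s) = Q q x by [].
apply: Qagree => r /andP[rq rNq]; apply: IH; last exact: Ddown Dq.
by rewrite -ltnS (leq_trans _ qn)// ltnS le_rank.
Qed.

End fixpoint.

Lemma sigma_algebra_canonical (D : pred I) :
  sigma_algebra setT (g_sigma_algebra_preimage (prod_space_proj S D)).
Proof. exact/sigma_algebra_preimage/sigma_algebra_measurable. Qed.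

(** [X] is the trajectory. The last clause says, with denominators cleared, that on the part of a
    cylinder below [p] cut out by an event [A] of the coordinates below [p], the law of [X] is
    proportional to its law on the whole cylinder. *)
Lemma ex_realization : exists X : prod_space S -> {ffun I -> nat},
  [/\ forall x, nu [set s | X s = x] = P [set w | Y w = x],
      forall p n, g_sigma_algebra_preimage (prod_space_proj S (le ^~ p))
        [set s | X s p = n] &
      forall p x A,
        g_sigma_algebra_preimage (prod_space_proj S (le ^~ p)) A ->
        pr nu (A `&` [set s | X s = x]) * pr nu (cyl X (le ^~ p) x) =
        pr nu (A `&` cyl X (le ^~ p) x) * pr nu [set s | X s = x]].
Proof.
have [Q [mQ Qagree lamQ]] := ex_transition_map.
pose X := trajectory Q.
have cylT x : [set s | X s = x] = cyl X predT x.
  apply/seteqP; split=> [s /= Xx q _|s Xx]; first by rewrite Xx.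
  by apply/ffunP => q; exact: Xx.
have mguard (D : pred I) x q : measurable [set u : U | D q -> Q q x u = x q].
  apply: (@measurable_guard _ _ (fun=> U) q (D q)
    (fun _ => Q q x @^-1` [set x q])).
  by move=> _; exact: measurable_nat_preimage.
have down p q r : le q r -> le r p -> le q p by move=> qr rp; exact: le_trans qr rp.
have Ccyl p x :
    g_sigma_algebra_preimage (prod_space_proj S (le ^~ p)) (cyl X (le ^~ p) x).
  exists (box (fun k : {k | le k p} => Q (sval k) x @^-1` [set x (sval k)])).
    by apply: measurable_box => k; exact: measurable_nat_preimage.
  rewrite setTI cyl_trajectory//; last exact: down.
  apply/seteqP; split => [s sx q qp|s sx [q qp]]; last exact: sx.
  exact: (sx (exist _ q qp)).
exists X; split=> [x|p n|p x A CA].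
- rewrite cylT cyl_trajectory// [LHS](hnu (mguard predT x)).
  transitivity (pr P [set w | Y w = x])%:E.
    rewrite (joint_law rank_inj le_rank)// -prodEFin; apply: eq_bigr => q _.
    rewrite -lamQ.
    by congr (lam _); apply/seteqP; split=> [u /(_ isT)|u Qu _].
  rewrite -prE// (_ : [set w | _] = cyl Y predT x); first exact: measurable_cyl.
  apply/seteqP; split=> [s /= Xx q _|s Xx]; first by rewrite Xx.
  by apply/ffunP => q; exact: Xx.
(* The event is the countable union of the cylinders below [p] of all configurations [x] with
   [x p = n], enumerated by their codes. *)
- pose G m : set (prod_space S) :=
    oapp (fun x : {ffun I -> nat} => if x p == n then cyl X (le ^~ p) x else set0)
      set0 (unpickle m).
  have [C0 _ CU] := sigma_algebra_canonical (fun q => le q p).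
  rewrite (_ : [set s | _] = \bigcup_m G m).
    apply: CU => m; rewrite /G; case: (unpickle m) => [x|//] /=; by case: ifP.
  apply/seteqP; split=> [s /= Xn|s [m _]].
    by exists (pickle (X s)) => //; rewrite /G pickleK /= Xn eqxx.
  rewrite /G; case: (unpickle m) => [x|//] /=; case: eqP => // xn /(_ p).
  by rewrite le_refl xn; exact.
(* Once [X] is fixed on the coordinates below [p], being equal to [x] only constrains the other
   coordinates of [s], hence an event independent of [A]. *)
- pose O := box (fun q => [set u : U | ~~ le q p -> (Q q x @^-1` [set x q]) u]).
  have XE : [set s | X s = x] = cyl X (le ^~ p) x `&` O.
    rewrite cylT !cyl_trajectory//; last exact: down.
    rewrite boxI; apply/seteqP; split=> s sx q; first by split=> _; exact: sx.
    move=> _; have [] := sx q.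
    by have [qp /(_ isT)//|qp _ /(_ isT)//] := boolP (le q p).
  have mO : measurable O.
    apply: measurable_box => q.
    apply: (@measurable_guard _ _ (fun=> U) q (~~ le q p)
      (fun _ => Q q x @^-1` [set x q])).
    by move=> _; exact: measurable_nat_preimage.
  have indep B : g_sigma_algebra_preimage (prod_space_proj S (le ^~ p)) B ->
      pr nu (B `&` O) = pr nu B * pr nu O.
    move=> CB; rewrite /pr [in LHS](product_probability_indep hnu CB); last first.
      by move=> q; exact: measurable_nat_preimage.
    have mB : measurable B.
      by case: CB => C mC <-; exact: measurable_prod_space_proj.
    by rewrite fineM// fin_num_measure.
  have CAE : g_sigma_algebra_preimage (prod_space_proj S (le ^~ p))
      (A `&` cyl X (le ^~ p) x).
    have [C1 mC1 <-] := CA; have [C2 mC2 <-] := Ccyl p x.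
    exists (C1 `&` C2); first exact: measurableI.
    by rewrite !setTI preimage_setI.
  by rewrite XE setIA !indep// mulrAC mulrA.
Qed.

End realization.

(** * Transfer of conditional expectations *)

Section transfer.
Context {R : realType} {I : finType}.

(** Coding the restriction to [D] by a natural number gives a variable whose nonempty fibres are the
    cylinders over [D], so sums over cylinders become sums over [nat]. *)
Lemma code_preimage (T : Type) (X : T -> {ffun I -> nat}) (D : pred I) n :
  (fun w => pickle (restr D (X w))) @^-1` [set n] = set0 \/
  exists x, (fun w => pickle (restr D (X w))) @^-1` [set n] = cyl X D x.
Proof.
have [[w wn]|nw] := pselect (exists w, pickle (restr D (X w)) = n); last first.
  by left; apply/seteqP; split => // w /= wn; apply: nw; exists w.
right; exists (X w); rewrite -wn; apply/seteqP; split=> v /=.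
  by move=> /(pcan_inj pickleK)/eq_restr.
by move=> vw; congr pickle; apply/eq_restr.
Qed.

Lemma restr_predT (x : {ffun I -> nat}) : restr predT x = x.
Proof. by apply/ffunP => q; rewrite ffunE. Qed.

Lemma cyl_predT (T : Type) (X : T -> {ffun I -> nat}) x :
  cyl X predT x = [set w | X w = x].
Proof.
apply/seteqP; split=> [w Xx|w /= Xx q _]; last by rewrite Xx.
by apply/ffunP => q; exact: Xx.
Qed.

Context d d' (T : measurableType d) (T' : measurableType d').
Variables (P : probability T R) (nu : probability T' R).
Variables (Y : T -> {ffun I -> nat}) (X : T' -> {ffun I -> nat}).
Hypothesis mY : forall q, measurable_fun setT (fun w => Y w q).
Hypothesis mX : forall q, measurable_fun setT (fun w => X w q).
Hypothesis XY : forall x, nu [set s | X s = x] = P [set w | Y w = x].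

Lemma measurable_code d0 (U : measurableType d0) (Z : U -> {ffun I -> nat}) D :
  (forall q, measurable_fun setT (fun w => Z w q)) ->
  measurable_fun setT (fun w => pickle (restr D (Z w))).
Proof.
move=> mZ; apply: measurable_nat_valued => n.
have [->|[x ->]] := code_preimage Z D n; first exact: measurable0.
exact: measurable_cyl.
Qed.

Definition uncode (h : {ffun I -> nat} -> R) n : R := oapp h 0 (unpickle n).

Lemma uncodeE (h : {ffun I -> nat} -> R) x :
  uncode h (pickle (restr predT x)) = h x.
Proof. by rewrite restr_predT /uncode pickleK. Qed.

Let Xc s := pickle (restr predT (X s)).
Let Yc w := pickle (restr predT (Y w)).

(** The alternative and the configuration [x] depend on [n] only, so the same case applies to [X]
    and to [Y]. *)
Lemma code_fibre (n : nat) :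
  (forall U (Z : U -> {ffun I -> nat}),
    (fun w => pickle (restr predT (Z w))) @^-1` [set n] = set0) \/
  exists x : {ffun I -> nat}, forall U (Z : U -> {ffun I -> nat}),
    (fun w => pickle (restr predT (Z w))) @^-1` [set n] = [set w | Z w = x].
Proof.
have [[x xn]|nx] := pselect (exists x : {ffun I -> nat}, pickle x = n).
  right; exists x => U Z.
  apply/seteqP; split=> [w|w] /=; rewrite restr_predT -xn; last by move=> ->.
  exact: (pcan_inj pickleK).
left => U Z; apply/seteqP; split => // w /= wn; apply: nx.
by exists (restr predT (Z w)).
Qed.

Lemma code_law n : nu (Xc @^-1` [set n]) = P (Yc @^-1` [set n]).
Proof.
by rewrite /Xc /Yc; have [H|[x H]] := code_fibre n; rewrite !H ?measure0.
Qed.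

(** There are countably many configurations, so equality of the point masses gives equality on every
    set [B]. *)
Lemma same_law B : nu (X @^-1` B) = P (Y @^-1` B).
Proof.
pose Bc := [set n | exists2 x : {ffun I -> nat}, B x & pickle x = n].
have H U (Z : U -> {ffun I -> nat}) :
    Z @^-1` B = (fun w => pickle (restr predT (Z w))) @^-1` Bc.
  apply/seteqP; split=> [w Bw|w [x Bx]] /=.
    by exists (Z w) => //; rewrite restr_predT.
  by move=> /(pcan_inj pickleK); rewrite restr_predT => <-.
have mXc := measurable_code predT mX; have mYc := measurable_code predT mY.
have mXB := measurable_nat_preimage Bc mXc.
have mYB := measurable_nat_preimage Bc mYc.
rewrite !H (measure_nat_valued _ mXB mXc) (measure_nat_valued _ mYB mYc).
apply: eq_eseriesr => n _; have [Bn|Bn] := pselect (Bc n); last first.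
  have H' U (Z : U -> nat) : Z @^-1` Bc `&` Z @^-1` [set n] = set0.
    by apply/seteqP; split=> // w [/= + /= Zn]; rewrite Zn.
  by rewrite !H' !measure0.
have H' U (Z : U -> nat) : Z @^-1` Bc `&` Z @^-1` [set n] = Z @^-1` [set n].
  by apply/seteqP; split=> [w []//|w /= ->].
by rewrite !H'; exact: code_law.
Qed.

Variables (G : set (set T')) (F : set (set T)) (D : pred I) (p : I).
Hypothesis sG : sigma_algebra setT G.
Hypothesis mG : G `<=` measurable.
Hypothesis GX : forall n, G [set s | X s p = n].
Hypothesis FY : forall x, F (cyl Y D x).
Hypothesis indep : forall x A, G A ->
  pr nu (A `&` [set s | X s = x]) * pr nu (cyl X D x) =
  pr nu (A `&` cyl X D x) * pr nu [set s | X s = x].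

Lemma integrable_transfer (h : {ffun I -> nat} -> R) :
  P.-integrable setT (EFin \o (h \o Y)) -> nu.-integrable setT (EFin \o (h \o X)).
Proof.
have hE U (Z : U -> {ffun I -> nat}) :
    EFin \o (h \o Z) = (EFin \o uncode h) \o (fun w => pickle (restr predT (Z w))).
  by apply/funext => w /=; rewrite uncodeE.
rewrite !hE; apply: (@integrable_nat_valued _ _ _ _ _ _ _ _ _ _ _ 1) => //.
- exact: measurable_code.
- exact: measurable_code.
- by move=> n; rewrite !setTI mul1e; exact: code_law.
Qed.

(** By [indep] and [XY], each configuration has on [A] within the cylinder of [X] the same multiple
    of its mass on the cylinder of [Y]; integrals scale by this factor. *)
Lemma integral_cyl_transfer (h : {ffun I -> nat} -> R) x A : G A ->
  P.-integrable setT (EFin \o (h \o Y)) ->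
  (\int[nu]_(s in A `&` cyl X D x) (h (X s))%:E =
   (pr nu (A `&` cyl X D x) / pr nu (cyl X D x))%:E *
   \int[P]_(w in cyl Y D x) (h (Y w))%:E)%E.
Proof.
move=> GA ih.
have mA := mG GA; have mC : measurable (cyl X D x) by exact: measurable_cyl.
have mCY : measurable (cyl Y D x) by exact: measurable_cyl.
have mAC : measurable (A `&` cyl X D x) by exact: measurableI.
have hE U (Z : U -> {ffun I -> nat}) w :
    (h (Z w))%:E = (EFin \o uncode h) (pickle (restr predT (Z w))).
  by rewrite /= uncodeE.
under eq_integral do rewrite hE.
under [in RHS]eq_integral do rewrite hE.
apply: (integral_nat_valued (measurable_code predT mX)
  (measurable_code predT mY)) => //.
- move=> n; have [H|[z H]] := code_fibre n; rewrite !H.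
    by rewrite !setI0 !measure0 mule0.
  have [zx|zx] := pselect (agree D z x); last first.
    have H0 U (Z : U -> {ffun I -> nat}) : cyl Z D x `&` [set w | Z w = z] = set0.
      apply/seteqP; split=> // w [Zx /= Zz]; apply: zx => q Dq.
      by rewrite -Zz Zx.
    by rewrite -setIA !H0 setI0 !measure0 mule0.
  have H1 U (Z : U -> {ffun I -> nat}) :
      cyl Z D x `&` [set w | Z w = z] = [set w | Z w = z].
    by apply/seteqP; split=> [w []//|w /= Zz]; split=> // q Dq; rewrite Zz zx.
  have mXz : measurable [set s | X s = z].
    by rewrite -cyl_predT; exact: measurable_cyl.
  have mAz : measurable (A `&` [set s | X s = z]) by exact: measurableI.
  rewrite -setIA !H1.
  transitivity ((pr nu (A `&` cyl X D x) / pr nu (cyl X D x))%:E *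
      nu [set s | X s = z])%E; last by congr (_ * _)%E; exact: XY.
  rewrite [X in (_ * X)%E](prE _ mXz) -EFinM [LHS](prE _ mAz); congr EFin.
  have := indep z GA; rewrite (cyl_agree X zx) => ind.
  (* For a null cylinder the factor is 0, as division by zero gives 0, and the left side is null by
     inclusion. *)
  have [C0|C0] := eqVneq (pr nu (cyl X D x)) 0; last first.
    by apply: (mulIf C0); rewrite ind mulrAC divfK// mulrC.
  rewrite C0 invr0 mulr0 mul0r; apply: pr_sub0 C0 => //.
  by rewrite -(H1 _ X) => s [_ []].
- apply: (@integrableS _ _ _ _ setT) => //.
  rewrite (_ : (_ \o _ : T -> \bar R) = EFin \o (h \o Y))//.
  by apply/funext => w; apply/esym; exact: hE.
Qed.

(** Cut an event of [G] along the cylinders of [X] over [D]. On each piece the integrals of both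
    functions are the same multiple of the integrals over a cylinder of [Y], which lies in [F];
    there the hypothesis equates them. *)
Lemma is_cond_expectation_transfer (f : {ffun I -> nat} -> R) (g : nat -> R) :
  is_cond_expectation P F (f \o Y) (fun w => g (Y w p)) ->
  is_cond_expectation nu G (f \o X) (fun s => g (X s p)).
Proof.
move=> [fi gi gF fg].
pose g' (x : {ffun I -> nat}) := g (x p).
have nfi := integrable_transfer fi.
have ngi : nu.-integrable setT (EFin \o (g' \o X)).
  exact: (@integrable_transfer g').
split => //.
- move=> _ [B mB <-]; rewrite setTI.
  rewrite (_ : _ @^-1` B = \bigcup_n
    (if n \in g @^-1` B then [set s | X s p = n] else set0)).
    case: sG => G0 _ GU; apply: GU => n; by case: ifP.
  apply/seteqP; split=> [s Bs|s [n _]].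
    by exists (X s p) => //; rewrite mem_set.
  by case: ifPn => // /set_mem Bn /= ->.
- move=> A GA; have mA := mG GA.
  pose Z s := pickle (restr D (X s)).
  have mZ : measurable_fun setT Z by exact: measurable_code.
  have mAZ n : measurable (A `&` Z @^-1` [set n]).
    by apply: measurableI => //; exact: measurable_nat_preimage.
  rewrite (nat_bigcup Z A) !integral_bigcup//; last 4 first.
  - exact: nat_trivIset.
  - by rewrite -nat_bigcup; exact: integrableS nfi.
  - exact: nat_trivIset.
  - by rewrite -nat_bigcup; exact: integrableS ngi.
  apply: eq_eseriesr => n _.
  have [->|[x ->]] := code_preimage X D n; first by rewrite setI0 !integral_set0.
  rewrite (@integral_cyl_transfer f)// (@integral_cyl_transfer g')//.
  by congr (_ * _)%E; exact: fg.
Qed.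

End transfer.

Lemma sigma_algebra_cyl (I : finType) (T : pointedType) (G : set (set T))
    (Y : T -> {ffun I -> nat}) (D : pred I) (x : {ffun I -> nat}) :
  sigma_algebra setT G -> (forall q, D q -> G [set w | Y w q = x q]) ->
  G (cyl Y D x).
Proof.
move=> sG GY; rewrite -(sigma_algebra_id sG).
rewrite (_ : cyl Y D x =
  \bigcap_(q in [set q | D q]) [set w | Y w q = x q]); last first.
  by apply/seteqP; split=> w Yx q /Yx.
apply: (@fin_bigcap_measurable _ (g_sigma_algebraType G)) => // q Dq.
by apply: sub_sigma_algebra; exact: GY.
Qed.

(** * Lexicographic order on the grid *)

Section filtration.
Context {R : realType} {N M : nat}.
Context d (Omega : measurableType d) (P : probability Omega R).
Context (F : 'I_N -> 'I_M -> set (set Omega)).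
Hypothesis hF : biparameter_filtration F.

Lemma filtration_le (i i' : 'I_N) (j j' : 'I_M) : (i <= i')%N -> (j <= j')%N ->
  F i j `<=` F i' j'.
Proof.
have [_ _ Fj Fi] := hF => ii' jj'.
apply: (@subset_trans _ (F i' j)).
  have [n] := ubnP (i' - i)%N; elim: n => // n IH in i ii' * => iin.
  have [ii|ii] := eqVneq i i'; first by rewrite ii; exact: subset_refl.
  have lti : (i < i')%N by rewrite ltn_neqAle ii' andbT.
  have ltN := leq_ltn_trans lti (ltn_ord i').
  apply: (@subset_trans _ (F (Ordinal ltN) j)); first exact: Fi.
  by apply: IH => //=; lia.
have [n] := ubnP (j' - j)%N; elim: n => // n IH in j jj' * => jjn.
have [jj|jj] := eqVneq j j'; first by rewrite jj; exact: subset_refl.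
have ltj : (j < j')%N by rewrite ltn_neqAle jj' andbT.
have ltM := leq_ltn_trans ltj (ltn_ord j').
apply: (@subset_trans _ (F i' (Ordinal ltM))); first exact: Fj.
by apply: IH => //=; lia.
Qed.

Definition grid_le (q p : 'I_N * 'I_M) := (q.1 <= p.1)%N && (q.2 <= p.2)%N.

(** Row-by-row numbering of the grid: as [q.2 < M], it realizes the lexicographic order, which
    extends the product order. *)
Definition lex_rank (q : 'I_N * 'I_M) : nat := (q.1 * M + q.2)%N.

Lemma lex_rank_lt q p : (lex_rank q < lex_rank p)%N =
  (q.1 < p.1)%N || ((q.1 == p.1) && (q.2 < p.2)%N).
Proof.
rewrite /lex_rank -val_eqE /=; have := ltn_ord q.2; have := ltn_ord p.2.
move: (q.1 : nat) (p.1 : nat) (q.2 : nat) (p.2 : nat) => a b c e eM cM.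
by case: (ltngtP a b) => [ab|ba|->] /=; nia.
Qed.

Lemma lex_rank_inj : injective lex_rank.
Proof.
move=> q p qp; have := lex_rank_lt q p; have := lex_rank_lt p q.
rewrite qp ltnn => /esym/norP[pq1 pq2] /esym/norP[qp1 qp2].
case: q p pq1 pq2 qp1 qp2 {qp} => [a b] [c e] /= ca cae ac ace.
have ac' : a = c by apply/val_inj/eqP; rewrite /= eqn_leq; lia.
move: cae ace; rewrite ac' eqxx /= => be eb.
by congr pair; apply/val_inj/eqP; rewrite /= eqn_leq; lia.
Qed.

Lemma grid_le_lex_rank q p : grid_le q p -> q != p -> (lex_rank q < lex_rank p)%N.
Proof.
case: q p => [a b] [c e]; rewrite lex_rank_lt /grid_le xpair_eqE /= -!val_eqE /=.
by move=> /andP[]; lia.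
Qed.

(** * Markov property along the lexicographic order *)

Context (Yr : 'I_N -> 'I_M -> Omega -> nat).
Hypothesis FY : forall i j A, F i j A <-> exists B, A = Yr i j @^-1` B.
Hypothesis hF4 : F4_condition P F.

Definition atoms (w : Omega) : {ffun 'I_N * 'I_M -> nat} :=
  [ffun p => Yr p.1 p.2 w].

Lemma filtration_atom (i : 'I_N) (j : 'I_M) q n : grid_le q (i, j) ->
  F i j [set w | atoms w q = n].
Proof.
move=> /andP[qi qj]; apply: (filtration_le qi qj); apply/FY; exists [set n].
by apply/seteqP; split=> w; rewrite /= ffunE.
Qed.

Lemma filtration_cyl (i : 'I_N) (j : 'I_M) (D : pred ('I_N * 'I_M)) x :
  (forall q, D q -> grid_le q (i, j)) -> F i j (cyl atoms D x).
Proof.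
move=> Dij; apply: sigma_algebra_cyl; first by case: hF.
by move=> q /Dij; exact: filtration_atom.
Qed.

Lemma measurable_atoms q : measurable_fun setT (fun w => atoms w q).
Proof.
have [_ mF _ _] := hF; apply: measurable_nat_valued => n; apply: (mF q.1 q.2).
by apply: filtration_atom; rewrite /grid_le !leqnn.
Qed.

(* [A] is the intersection of [A1] in F_{i-1,M} and [B] in F_{i,j}, and [V] is
   [B] intersected with the atom [D] of F_{i-1,j}; (F_4) is applied to both [B]
   and [B `&` C]. *)
Lemma lex_markov p x :
  let A := cyl atoms (fun q => lex_rank q < lex_rank p)%N x in
  let V := cyl atoms (slt grid_le ^~ p) x in let C := [set w | atoms w p = x p] in
  pr P (A `&` C) * pr P V = pr P A * pr P (V `&` C).
Proof.
move=> A V C; case: p @A @V @C => i j A V C.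
have [_ mF _ _] := hF.
(* [A1] fixes all earlier rows, [B] the earlier entries of row [i], and [D] the earlier rows up to
   column [j]. *)
pose A1 := cyl atoms (fun q => q.1 < i)%N x.
pose B := cyl atoms (fun q => (q.1 == i) && (q.2 < j)%N) x.
pose D := cyl atoms (fun q => (q.1 < i)%N && (q.2 <= j)%N) x.
have AE : A = A1 `&` B.
  apply/seteqP; split=> [w Aw|w [A1w Bw] q].
    by split=> q /= qi; apply: Aw; rewrite /= lex_rank_lt /= qi ?orbT.
  by rewrite lex_rank_lt => /orP[/A1w|/Bw].
have VE : V = B `&` D.
  apply/seteqP; split=> [w Vw|w [Bw Dw] [a b]].
    split=> -[a b] /= /andP[ai bj]; apply: Vw;
      rewrite /slt /grid_le /= xpair_eqE -!val_eqE /=.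
      by move: ai; rewrite -val_eqE /=; lia.
    by lia.
  rewrite /slt /grid_le /= xpair_eqE -!val_eqE /= => ab.
  have [ai|ai] := ltnP a i; first by apply: Dw; rewrite /= ai; lia.
  by apply: Bw; rewrite /= -val_eqE /=; lia.
have A1D : A1 `<=` D by move=> w A1w q /andP[/A1w].
(* In the first row there are no earlier rows, so the two conditioning events coincide. *)
have [i0|i0] := posnP i.
  have AV : A = V.
    rewrite AE VE setIC; congr (_ `&` _); apply/seteqP; split=> // w _ q.
    by rewrite i0.
  by rewrite AV mulrC.
have i1N : (i.-1 < N)%N by have := ltn_ord i; lia.
have M1M : (M.-1 < M)%N by have := ltn_ord j; lia.
pose i1 : 'I_N := Ordinal i1N; pose m : 'I_M := Ordinal M1M.
have i1i : (i1 <= i)%N by rewrite /=; lia.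
have jm : (j <= m)%N by have := ltn_ord j; rewrite /=; lia.
have minE : Order.min i1 i = i1 by apply/min_idPl; rewrite leEord.
have minE' : Order.min m j = j by apply/min_idPr; rewrite leEord.
have FA1 : F i1 m A1.
  apply: filtration_cyl => -[a b] /= ai.
  by apply/andP; split=> /=; have := ltn_ord b; lia.
have FB : F i j B.
  by apply: filtration_cyl => -[a b]; rewrite /grid_le /= -val_eqE /=; lia.
have FC : F i j C by apply: filtration_atom; rewrite /grid_le !leqnn.
have FD : F i1 j D.
  by apply: filtration_cyl => -[a b]; rewrite /grid_le /=; lia.
have FD' : F i j D by exact: (filtration_le i1i (leqnn j)).
have FBC : F i j (B `&` C).
  have /FY[B1 ->] := FB; have /FY[B2 ->] := FC.
  by apply/FY; exists (B1 `&` B2).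
(* [D] fixes in particular the label at [(i1, j)], hence lies in one atom of [F i1 j]. *)
have Dx : D `<=` Yr i1 j @^-1` [set x (i1, j)].
  move=> w /(_ (i1, j)); rewrite /= ffunE; apply; rewrite leqnn andbT.
  by rewrite ltn_predL.
have indep B' : F i j B' ->
    pr P (A1 `&` (B' `&` D)) * pr P D = pr P (A1 `&` D) * pr P (B' `&` D).
  move=> FB'; apply: (F4_cond_indep FY mF hF4 FA1 FB' FD').
    by rewrite minE minE'.
  by rewrite minE minE'; exact: Dx.
have A1DE : A1 `&` D = A1 by apply/setIidPl.
have E1 : A `&` C = A1 `&` ((B `&` C) `&` D).
  by rewrite AE -[in LHS]A1DE -!setIA; congr (_ `&` _); rewrite setIC -!setIA.
have E2 : A = A1 `&` (B `&` D).
  by rewrite AE -[in LHS]A1DE -!setIA; congr (_ `&` _); rewrite setIC.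
have E3 : V `&` C = (B `&` C) `&` D by rewrite VE -!setIA [D `&` C]setIC.
have mA1 := mF _ _ _ FA1; have mB := mF _ _ _ FB; have mC := mF _ _ _ FC.
have mD := mF _ _ _ FD.
have I1 := indep _ FBC; have I2 := indep _ FB.
(* The two product formulas are combined by cancelling the mass of [D]; if it is 0, then [A] is null
   and both sides vanish. *)
have [D0|D0] := eqVneq (pr P D) 0.
  rewrite (@pr_sub0 _ _ _ P (A `&` C) D)//; last 2 first.
  - by rewrite AE; do !apply: measurableI.
  - by rewrite AE => w [[/A1D]].
  rewrite mul0r [X in X * _](@pr_sub0 _ _ _ P A D) ?mul0r//.
    by rewrite AE; exact: measurableI.
  by rewrite AE => w [/A1D].
apply: (mulIf D0); rewrite {2}E2 E1 E3 VE mulrAC I1 -[RHS]mulrAC I2.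
by rewrite mulrAC.
Qed.

End filtration.

(** * Factorization through the atoms and construction of the martingale *)

(** The level set of [f] through [w] belongs to [G], hence contains the whole fibre of [Y] through
    [w]. So [g n] can be read off at any point of the fibre over [n]. *)
Lemma measurable_fun_atom (R : realType) (T : pointedType) (G : set (set T))
    (Y : T -> nat) (f : T -> R) :
  (forall A, G A <-> exists B, A = Y @^-1` B) ->
  preimage_set_system setT f measurable `<=` G ->
  exists g : nat -> R, forall w, f w = g (Y w).
Proof.
move=> GY fG; exists (fun n => f (get [set w | Y w = n])) => w.
have Yw : Y (get [set v | Y v = Y w]) = Y w.
  by apply: (@getPex _ [set v | Y v = Y w]); exists w.
have /GY[B BE] : G (f @^-1` [set f w]).
  by apply: fG; exists [set f w]; [exact: measurable_set1|rewrite setTI].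
have /(congr1 (fun A => A w)) /= BYw := BE.
have /(congr1 (fun A => A (get [set v | Y v = Y w]))) /= := BE.
by move=> fE; apply/esym; rewrite fE Yw -BYw.
Qed.

Theorem theorem2 (R : realType) (N M : nat) (hN : (0 < N)%N) (hM : (0 < M)%N)
    (d : measure_display) (Omega : measurableType d) (P : probability Omega R)
    (hOmega : countable [set: Omega])
    (F : 'I_N -> 'I_M -> set (set Omega))
    (hF : biparameter_filtration F) (hF4 : F4_condition P F) :
  exists (e : 'I_N * 'I_M -> measure_display)
    (S : forall p : 'I_N * 'I_M, measurableType (e p))
    (mu : forall p : 'I_N * 'I_M, probability (S p) R)
    (nu : probability (prod_space S) R),
    is_product_probability mu nu /\
    forall f : 'I_N -> 'I_M -> Omega -> R,
      biparameter_martingale P F f ->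
      exists f' : 'I_N -> 'I_M -> prod_space S -> R,
        biparameter_martingale nu (canonical_filtration S) f' /\
        same_joint_distribution P nu f f'.
Proof.
have [sF mF _ _] := hF.
have [Yr FY] : exists Yr : 'I_N -> 'I_M -> Omega -> nat,
    forall i j A, F i j A <-> exists B, A = Yr i j @^-1` B.
  have /choice[Z ZP] (p : 'I_N * 'I_M) :=
    sigma_algebra_countable_rv hOmega (sF p.1 p.2).
  by exists (fun i j => Z (i, j)) => i j; exact: (ZP (i, j)).
(* Every factor is the real line with the uniform law on the unit interval. These spaces, and the
   map [X] below, are fixed before any martingale is given. *)
pose U : measurableType _ := measurableTypeR R.
pose lam : probability U R := uniform_prob (@ltr01 R).
pose S := fun _ : 'I_N * 'I_M => U.
have [nu hnu] := ex_product_probability (fun p => lam : probability (S p) R).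
have grid_refl : reflexive (@grid_le N M) by move=> p; rewrite /grid_le !leqnn.
have grid_trans : transitive (@grid_le N M).
  move=> q p r /andP[pq1 pq2] /andP[qr1 qr2].
  by rewrite /grid_le (leq_trans pq1)// (leq_trans pq2).
have mY := measurable_atoms hF FY.
have [X [XY CX indep]] := ex_realization grid_refl grid_trans (@lex_rank_inj N M)
  (@grid_le_lex_rank N M) mY (lex_markov hF FY hF4) (@ex_quantile R) hnu.
have CE i j : canonical_filtration S i j =
  g_sigma_algebra_preimage (prod_space_proj S ((@grid_le N M) ^~ (i, j))) by [].
have mC i j : canonical_filtration S i j `<=` measurable.
  by move=> _ [C mC <-]; exact: measurable_prod_space_proj.
have mX q : measurable_fun setT (fun s => X s q).
  apply: measurable_nat_valued => n; apply: (mC q.1 q.2).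
  by rewrite CE -surjective_pairing; exact: CX.
exists _, S, (fun=> lam), nu; split => // f mf.
have [g gE] : exists g : 'I_N -> 'I_M -> nat -> R,
    forall i j w, f i j w = g i j (Yr i j w).
  have /choice[g gP] (p : 'I_N * 'I_M) : exists g : nat -> R,
      forall w, f p.1 p.2 w = g (Yr p.1 p.2 w).
    have [_ _ fF _] := mf p.1 p.1 p.2 p.2 (leqnn _) (leqnn _).
    exact: measurable_fun_atom (@FY p.1 p.2) fF.
  by exists (fun i j => g (i, j)) => i j; exact: (gP (i, j)).
(* The same functions [g i j] of the labels are applied to the simulated labels. *)
exists (fun i j s => g i j (X s (i, j))); split.
  move=> i i' j j' ii' jj'.
  apply: (@is_cond_expectation_transfer _ _ _ _ _ _ P nu (atoms Yr) X mY mX XY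
    _ (F i j) ((@grid_le N M) ^~ (i, j)) (i, j) _ _ _ _ _
    (fun x => g i' j' (x (i', j')))) => //.
  - exact: sigma_algebra_canonical.
  - by move=> n; rewrite CE; exact: CX.
  - by move=> x; exact: (filtration_cyl hF FY).
  - by move=> x A; rewrite CE; exact: indep.
  rewrite (_ : _ \o atoms Yr = f i' j').
    rewrite (_ : (fun w => _) = f i j); first exact: mf.
    by apply/funext => w; rewrite ffunE gE.
  by apply/funext => w; rewrite /= ffunE gE.
move=> B mB; rewrite /pushforward.
(* Both random vectors are the image under [Phi] of a configuration, and the two configurations have
   the same law. *)
pose Phi (x : {ffun 'I_N * 'I_M -> nat}) :
  prod_space (fun _ : 'I_N * 'I_M => measurableTypeR R) := fun p => g p.1 p.2 (x p).
have -> : random_vector f = Phi \o atoms Yr.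
  apply/funext => w; apply: functional_extensionality_dep => p.
  by rewrite /random_vector /Phi/= ffunE gE.
have -> : random_vector (fun i j s => g i j (X s (i, j))) = Phi \o X.
  by apply/funext => s; apply: functional_extensionality_dep => -[i j].
exact: (esym (same_law mY mX XY (Phi @^-1` B))).
Qed.
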